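(* Fix integers $d_1,\dots,d_c\ge 2$ and a positive integer $n$. There exists an integer $m$, depending only on $d_1,\dots,d_c$ and $n$, such that the following holds: if $N$ is any positive integer and $f_1,\dots,f_c\in\mathbb{C}[x_0,\dots,x_N]$ are any homogeneous polynomials of degrees $d_1,\dots,d_c$ having collective strength at least $m$, then the $n$-plane sections of $V(f_1,\dots,f_c)\subseteq\mathbb{P}^N$ dominate the space of complete intersections of degrees $d_1,\dots,d_c$ in $\mathbb{P}^n$.
   Context: Everything is over $\mathbb{C}$. Strength: a nonzero homogeneous polynomial $f$ of degree $d$ has strength $s$ if it can be written as $f=\sum_{i=0}^{s}g_ih_i$ with $g_i,h_i$ homogeneous, $1\le\deg(g_i),\deg(h_i)\le d-1$, and $s$ is minimal with this property (strength $\infty$ if no such expression exists); the zero polynomial has strength $-\infty$. Homogeneous polynomials $f_1,\dots,f_c$ have collective strength at least $m$ if every nontrivial homogeneous $\mathbb{C}$-linear combination of them (coefficients not all zero, nonzero only on polynomials of a single degree) has strength at least $m$. Dominance: let $G$ be the space of parametrized $n$-planes, i.e. of linear maps $\phi:\mathbb{P}^n\to\mathbb{P}^N$ mapping $\mathbb{P}^n$ isomorphically onto an $n$-plane (given by injective linear maps $\mathbb{C}^{n+1}\to\mathbb{C}^{N+1}$), and let $S_{e}$ be the vector space of homogeneous polynomials of degree $e$ on $\mathbb{P}^n$. ''The $n$-plane sections of $V(f_1,\dots,f_c)$ dominate the space of complete intersections of degrees $d_1,\dots,d_c$ in $\mathbb{P}^n$'' means that the map $G\to\prod_{i=1}^cS_{d_i}$,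 $\phi\mapsto(\phi^*f_1,\dots,\phi^*f_c)$, is dominant (has dense image). *)

(* Defs.v *)
(* mpoly must be imported before boolp, classical_sets, reals and
   constructive_ereal: in the other order the notation levels clash. *)
From HB Require Import structures.
From mathcomp Require Import all_boot all_order all_algebra.
From mathcomp Require Import mpoly.
From mathcomp Require Import boolp classical_sets reals constructive_ereal.
From mathcomp Require Import complex.

Set Implicit Arguments.
Unset Strict Implicit.
Unset Printing Implicit Defensive.

Import Order.TTheory GRing.Theory Num.Theory.
Local Open Scope ring_scope.

Section Strength.
Context {K : fieldType} {n : nat}.

(* In {mpoly K[n]} the zero polynomial is homogeneous of every degree, so some
   terms may vanish here. For f != 0 this does not change the least s. *)
Definition has_strength_decomp (d : nat) (f : {mpoly K[n]}) (s : nat) : Prop :=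
  exists g h : 'I_s.+1 -> {mpoly K[n]},
    (forall i, exists u v : nat,
       [/\ (1 <= u <= d - 1)%N, (1 <= v <= d - 1)%N,
           g i \is u.-homog & h i \is v.-homog]) /\
    f = \sum_i g i * h i.

(* (msize f).-1 is the degree of a nonzero f. *)
Definition strength (f : {mpoly K[n]}) : \bar int :=
  if f == 0 then -oo%E
  else if pselect (exists s, `[< has_strength_decomp (msize f).-1 f s >])
    is left ex_s then (ex_minn ex_s)%:Z%:E
  else +oo%E.

Definition collective_strength_ge (c : nat) (d : 'I_c -> nat)
    (f : forall i, dhomog n K (d i)) (m : int) : Prop :=
  forall a : 'I_c -> K,
    (exists i, a i != 0) ->
    (exists e : nat, forall i, a i != 0 -> d i = e) ->
    (m%:E <= strength (\sum_i a i *: (f i : {mpoly K[n]})))%E.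

End Strength.

Section Planes.
Context {K : fieldType}.

Definition parametrized_plane (N n : nat) : Type :=
  {A : 'M[K]_(N.+1, n.+1) |
    injective (fun v : 'cV[K]_n.+1 => A *m v)}.

Definition pullback_mpoly (N n : nat) (A : 'M[K]_(N.+1, n.+1))
    (f : {mpoly K[N.+1]}) : {mpoly K[n.+1]} :=
  f \mPo [tuple \sum_j A i j *: 'X_j | i < N.+1].

Lemma pullback_mpoly_dhomog N n (A : 'M[K]_(N.+1, n.+1)) e f :
  f \is e.-homog -> pullback_mpoly A f \is e.-homog.
Proof.
move=> /dhomogP homf; rewrite /pullback_mpoly comp_mpolyEX big_seq rpred_sum //.
move=> m /homf /= <-; rewrite rpredZ // comp_mpolyX mdegE.
apply: (big_rec2 (fun (p : {mpoly K[n.+1]}) k => p \is k.-homog)).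
  exact: dhomog1.
move=> i p k _ homp; apply: dhomogM => //.
have := dhomogMn (m i) (_ : tnth [tuple \sum_j A i j *: 'X_j | i < N.+1] i
  \is 1.-homog); rewrite mul1n; apply.
rewrite tnth_mktuple rpred_sum // => j _.
by rewrite rpredZ // dhomogX; apply/eqP/mdeg1.
Qed.

Definition pullback (N n e : nat) (A : 'M[K]_(N.+1, n.+1))
    (f : dhomog N.+1 K e) : dhomog n.+1 K e :=
  DHomog (pullback_mpoly_dhomog A (dhomog_is_dhomog f)).

End Planes.

Section Dominance.
Local Open Scope classical_set_scope.
Context {K : fieldType} {c : nat}.

Definition forms (n : nat) (d : 'I_c -> nat) : Type :=
  forall i : 'I_c, dhomog n.+1 K (d i).

Section Zariski.
Context {n : nat} {d : 'I_c -> nat}.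

(* The coefficients F |-> (F i)@_m are the linear coordinates on [forms n d];
   a polynomial function is a polynomial in finitely many of them. *)
Definition polynomial_fun (phi : forms n d -> K) : Prop :=
  exists (k : nat) (i : 'I_k -> 'I_c) (m : 'I_k -> 'X_{1..n.+1})
         (P : {mpoly K[k]}),
    forall F, phi F = P.@[fun j => (F (i j))@_(m j)].

Definition zariski_closed (Z : set (forms n d)) : Prop :=
  exists2 E : set (forms n d -> K), E `<=` polynomial_fun &
    Z = [set F | forall phi, E phi -> phi F = 0].

Definition dominant (T : Type) (u : T -> forms n d) : Prop :=
  smallest zariski_closed (range u) = setT.

End Zariski.

Definition plane_section (N n : nat) (d : 'I_c -> nat) (f : forms N d)
    (phi : @parametrized_plane K N n) : forms n d :=
  fun i => pullback (sval phi) (f i).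

End Dominance.
Arguments forms K {c} n d.
Arguments plane_section {K c N} n {d} f phi.

(* Main.v *)
Require Import Defs.
From HB Require Import structures.
From mathcomp Require Import all_boot all_order all_algebra.
From mathcomp Require Import mpoly.
From mathcomp Require Import boolp classical_sets reals constructive_ereal.
From mathcomp Require Import complex.

Set Implicit Arguments.
Unset Strict Implicit.
Unset Printing Implicit Defensive.

Import Order.TTheory GRing.Theory Num.Theory.
Local Open Scope ring_scope.

(** Let Y be a generic matrix with N+1 rows and n+1 columns.  The coefficients
    f_{i,al}(Y) of the forms f_i(Y x) in x are forms of degree d_i in the
    entries of Y, and the plane sections are dense as soon as the f_{i,al} are
    algebraically independent: a polynomial vanishing on all plane sections
    would be a relation between them, because the injective matrices are Zariski
    dense when n <= N ([eq0_of_injective_vanishing]).  That N is large follows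
    from Euler's identity, which bounds the strength of a form in N+1 variables
    by N ([low_combination_nvars]).

    A combination of the f_{i,al} of low strength yields one of the f_i:
    substituting the rank one matrix Y_kj = v_k x_j turns f_{i,al} into a
    nonzero multiple of x^al f_i(v) ([low_combination_section_coef]).  Hence
    everything rests on one statement ([jacobian_dep_low_combination]):
    algebraically dependent forms, of bounded number and degrees, over a domain
    A of characteristic zero, have a nontrivial homogeneous linear combination
    that is a sum of boundedly many products of forms of smaller degree.

    The proof of that statement is an induction on the degrees, run over all
    domains of characteristic zero at once. By the chain rule an algebraic
    relation gives a syzygy sum_i g_i del_j f_i = 0, the same for every
    partial derivative del_j. Choose f_c of top degree with g_c <> 0, let t be
    a generic point and D = sum_j t_j del_j. Applying D to the syzygy gives a
    syzygy between the f_i and the D f_i; eliminating del_j f_c between the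
    two leaves a nonzero syzygy in which f_c is replaced by the forms D f_i,
    all of smaller degree ([jacobian_dep_replaced]). By induction some
    combination S = sum a_i f_i + sum b_i D f_i, with a_i and b_i in A[t], has
    low strength. If it does not involve the D f_i at a suitable point t = v,
    specialize t to v. Otherwise differentiate S with respect to t in the
    direction x, at t = v: by the product rule this at most doubles the number
    of products, and by Euler's identity D f_i becomes deg(f_i) f_i, while all
    other terms are products of a linear form and a form
    ([low_combination_replaced]). Working over domains instead of fields makes
    A[t] an admissible base, so that no denominators arise. *)

(** * Homogeneous polynomials and partial derivatives *)

Lemma dhomog_of_coeff (A : nzRingType) n e (p : {mpoly A[n]}) :
  (forall m, mdeg m != e -> p@_m = 0) -> p \is e.-homog.
Proof.
move=> hp; apply/dhomogP => m; rewrite mcoeff_msupp => pm.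
by apply/eqP; apply: contraNT pm => /hp ->.
Qed.

Lemma mderiv_dhomog (A : nzRingType) n e (p : {mpoly A[n]}) j :
  p \is e.-homog -> mderiv j p \is e.-1.-homog.
Proof.
move=> hp; apply: dhomog_of_coeff => m me.
rewrite mcoeff_deriv (dhomog_nemf_coeff hp) ?mul0rn //= mdegD mdeg1 addn1.
by apply: contraNneq me => <-.
Qed.

Lemma map_mpoly_dhomog (A B : nzRingType) (ev : {additive A -> B}) n e
    (p : {mpoly A[n]}) :
  p \is e.-homog -> map_mpoly ev p \is e.-homog.
Proof.
move=> hp; apply: dhomog_of_coeff => m me.
by rewrite mcoeff_map_mpoly (dhomog_nemf_coeff hp) // raddf0.
Qed.

Lemma mderiv_map_mpoly (A B : nzRingType) (ev : {additive A -> B}) n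
    (p : {mpoly A[n]}) j :
  mderiv j (map_mpoly ev p) = map_mpoly ev (mderiv j p).
Proof.
by apply/mpolyP => m; rewrite !(mcoeff_deriv, mcoeff_map_mpoly) raddfMn.
Qed.

Lemma euler_mpoly (A : comNzRingType) n e (p : {mpoly A[n]}) :
  p \is e.-homog -> \sum_j 'X_j * mderiv j p = e%:R *: p.
Proof.
move=> /dhomogP hp; rewrite {2}[p]mpolyE scaler_sumr.
under eq_bigr do rewrite /mderiv mulr_sumr.
rewrite exchange_big /=; apply: eq_big_seq => m mp.
have <- : mdeg m = e by exact: hp.
rewrite mdegE natr_sum scaler_suml; apply: eq_bigr => j _.
rewrite -scalerAr scalerA -mpolyXD.
have [->|mj] := eqVneq (m j) 0%N; first by rewrite !mul0r !scale0r.
by rewrite addmC submK // lep1mP.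
Qed.

(** * Chain rule and nonvanishing in characteristic zero *)

Lemma mpoly_ring_ind (A : nzRingType) n (P : {mpoly A[n]} -> Prop) :
    (forall c, P c%:MP) -> (forall i, P 'X_i) ->
    (forall p q, P p -> P q -> P (p + q)) ->
    (forall p q, P p -> P q -> P (p * q)) ->
  forall p, P p.
Proof.
move=> PC PX PD PM p; rewrite [p]mpolyE.
apply: big_ind => [||m _] //; first by rewrite -mpolyC0; apply: PC.
rewrite -mul_mpolyC mpolyXE_id; apply: (PM _ _ (PC _)).
apply: big_ind => [||i _] //; first by rewrite -mpolyC1; apply: PC.
elim: (m i) => [|k IH]; first by rewrite expr0 -mpolyC1; apply: PC.
by rewrite exprS; apply: PM.
Qed.

(** Stated for an abstract derivation D so as to cover both the partial
    derivatives of a composite of polynomials and the derivative of the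
    restriction of a polynomial to a line. *)
Lemma mmap_chain_rule (A : comNzRingType) (S : comNzRingType) n
    (f : {rmorphism A -> S}) (h : 'I_n -> S) (D : {additive S -> S})
    (p : {mpoly A[n]}) :
    (forall x y, D (x * y) = D x * y + x * D y) -> (forall a, D (f a) = 0) ->
  D (mmap f h p) = \sum_i mmap f h (mderiv i p) * D (h i).
Proof.
move=> DM Df; elim/mpoly_ring_ind: p => [c|i|p q IHp IHq|p q IHp IHq].
- by rewrite mmapC Df big1 // => i _; rewrite mderivC mmap0 mul0r.
- rewrite mmapX mmap1U (bigD1 i) //= mderivX mnm1E eqxx scale1r.
  have -> : (U_(i) - U_(i) = 0)%MM.
    by apply/mnmP => k; rewrite mnmBE subnn mnm0E.
  rewrite mpolyX0 rmorph1 mul1r big1 ?addr0 // => j ji.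
  by rewrite mderivX mnm1E eq_sym (negbTE ji) scale0r mmap0 mul0r.
- rewrite mmapD raddfD /= IHp IHq -big_split /=; apply: eq_bigr => i _.
  by rewrite mderivD mmapD mulrDl.
- rewrite rmorphM DM /= IHp IHq mulr_suml mulr_sumr -big_split /=.
  apply: eq_bigr => i _; rewrite mderivM mmapD !rmorphM /= mulrDl -!mulrA.
  by rewrite (mulrC (D _)).
Qed.

Section CharZero.
Variables (A : idomainType).
Hypothesis A0 : [pchar A] =i pred0.

Lemma pchar0_natr_eq0 k : (k%:R == 0 :> A) = (k == 0)%N.
Proof. by have /pcharf0P -> := A0. Qed.

Lemma mpoly_pchar0 n : [pchar {mpoly A[n]}] =i pred0.
Proof.
move=> p; apply/negbTE; rewrite inE negb_and -implybE; apply/implyP => pp.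
rewrite -mpolyC_nat mpolyC_eq0 pchar0_natr_eq0.
by case: p pp.
Qed.

Lemma pchar0_mulrn_eq0 (x : A) k : (x *+ k.+1 == 0) = (x == 0).
Proof. by rewrite -mulr_natr mulf_eq0 pchar0_natr_eq0 orbF. Qed.

Lemma mderiv_eq0_const n (p : {mpoly A[n]}) :
  (forall j, mderiv j p = 0) -> p = (p@_0%MM)%:MP.
Proof.
move=> dp; apply/mpolyP => m; rewrite mcoeffC.
have [->|m0] := eqVneq m 0%MM; first by rewrite mulr1.
rewrite mulr0; have [j mj] : exists j, m j != 0%N.
  apply/existsP; apply: contraR m0; rewrite negb_exists => /forallP m0.
  by apply/eqP/mnmP => j; rewrite mnm0E; apply/eqP; have := m0 j; rewrite negbK.
have := congr1 (mcoeff (m - U_(j))%MM) (dp j).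
rewrite mcoeff_deriv submK ?lep1mP // mcoeff0 => /eqP.
by rewrite pchar0_mulrn_eq0 => /eqP.
Qed.

Lemma msize_mderiv n (p : {mpoly A[n]}) j k :
  (msize p <= k.+1)%N -> (msize (mderiv j p) <= k)%N.
Proof.
move=> pk; rewrite msizeE; apply/bigmax_leqP_seq => m; rewrite mcoeff_msupp.
rewrite mcoeff_deriv => pm _.
suff /msize_mdeg_lt : (m + U_(j))%MM \in msupp p.
  by rewrite mdegD mdeg1 addn1 => /leq_trans /(_ pk).
by rewrite mcoeff_msupp; apply: contraNneq pm => ->; rewrite mul0rn.
Qed.

Lemma poly_nat_root (q : {poly A}) : (forall k : nat, q.[k%:R] = 0) -> q = 0.
Proof.
move=> q0; apply/eqP; apply: contraT => qn0.
have /= := max_poly_roots qn0 (rs := [seq k%:R | k <- iota 0 (size q)]).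
rewrite size_map size_iota ltnn => -> //.
  by apply/allP => _ /mapP [k _ ->]; apply/eqP.
rewrite map_inj_uniq ?iota_uniq // => k l /eqP.
wlog lekl : k l / (k <= l)%N.
  by move=> H; case/orP: (leq_total k l) => /H // H1; rewrite eq_sym => /H1.
rewrite eq_sym -subr_eq0 -natrB // pchar0_natr_eq0 subn_eq0 => lelk.
by apply/eqP; rewrite eqn_leq lekl.
Qed.

(** If p vanishes everywhere then so do its partial derivatives, since p is
    zero on every line parallel to an axis; by induction on the degree these
    derivatives are zero, so p is a constant, hence zero. *)
Lemma mpoly_neq0_eval n (p : {mpoly A[n]}) : p != 0 -> exists v, p.@[v] != 0.
Proof.
move=> pn0; apply: contrapT => noV.
have {noV} : forall v, p.@[v] = 0.
  by move=> v; apply/eqP; apply: contraT => pv; case: noV; exists v.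
suff {pn0} H k : forall q : {mpoly A[n]}, (msize q <= k)%N ->
    (forall v, q.@[v] = 0) -> q = 0.
  by move=> /(H _ p (leqnn _)) p0; rewrite p0 eqxx in pn0.
elim: k => [|k IH] q qk qv; first by apply/eqP; rewrite -msize_poly_eq0 -leqn0.
have dq j : mderiv j q = 0.
  apply: (IH _ (msize_mderiv j qk)) => v.
  (* The line through v in the direction of the j-th axis. *)
  pose h i : {poly A} := (v i)%:P + (i == j)%:R *: 'X.
  have hE x r : (mmap (@polyC A) h r).[x] = r.@[fun i => v i + (i == j)%:R * x].
    rewrite /mmap mevalE -horner_evalE raddf_sum; apply: eq_bigr => m _ /=.
    rewrite horner_evalE hornerM hornerC /mmap1 horner_prod.
    by congr (_ * _); apply: eq_bigr => i _; rewrite horner_exp /h !hornerE.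
  have q0 : mmap (@polyC A) h q = 0 by apply: poly_nat_root => x; rewrite hE.
  have := mmap_chain_rule (f := @polyC A) h q (D := @deriv A)
     (@derivM A) (@derivC A).
  rewrite q0 /= deriv0 (bigD1 j) //= big1 => [|i /negbTE ij]; last first.
    by rewrite /h ij scale0r addr0 derivC mulr0.
  rewrite /h eqxx scale1r derivD derivC derivX add0r mulr1 addr0.
  move=> /esym /(congr1 (horner^~ 0)); rewrite horner0 hE => <-.
  by apply: meval_eq => i; rewrite mulr0 addr0.
have qC := mderiv_eq0_const dq.
have := qv (fun=> 0); rewrite qC mevalC => q0.
by rewrite q0 mpolyC0.
Qed.

End CharZero.

(** * Sums of few products of forms of positive degree *)

(** At most m products of forms of positive degrees summing to e. For a
    nonzero form of degree e this says that its strength is less than m.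
    Counting products rather than strength makes sums and the zero form
    uniform, and the notion makes sense over any base ring. *)
Inductive low_strength (A : nzRingType) n (e : nat) :
    nat -> {mpoly A[n]} -> Prop :=
| low_strength0 m : low_strength e m 0
| low_strengthS m u v g h p :
    (0 < u)%N -> (0 < v)%N -> (u + v)%N = e ->
    g \is u.-homog -> h \is v.-homog ->
    low_strength e m p -> low_strength e m.+1 (g * h + p).

Section LowStrength.
Variables (A : comNzRingType) (n : nat).
Implicit Types (p q : {mpoly A[n]}).

Lemma low_strength_leq e m m' p :
  (m <= m')%N -> low_strength e m p -> low_strength e m' p.
Proof.
move=> lem lp; elim: lp m' lem => {m p} [m|m u v g h p u0 v0 uv hg hh _ IH] m'.
  by move=> _; apply: low_strength0.
case: m' => [//|m' lem].
by apply: (low_strengthS u0 v0 uv hg hh); apply: IH.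
Qed.

Lemma low_strengthM e u v g h :
    (0 < u)%N -> (0 < v)%N -> (u + v)%N = e ->
    g \is u.-homog -> h \is v.-homog ->
  low_strength e 1 (g * h : {mpoly A[n]}).
Proof.
move=> u0 v0 uv hg hh; rewrite -[g * h]addr0.
by apply: (low_strengthS u0 v0 uv hg hh); apply: low_strength0.
Qed.

Lemma low_strengthD e m m' p q :
  low_strength e m p -> low_strength e m' q -> low_strength e (m + m') (p + q).
Proof.
move=> lp lq; elim: lp => {m p} [m|m u v g h p u0 v0 uv hg hh _ IH].
  by rewrite add0r; apply: low_strength_leq lq; apply: leq_addl.
by rewrite -addrA addSn; apply: (low_strengthS u0 v0 uv hg hh).
Qed.

Lemma low_strengthZ e m c p : low_strength e m p -> low_strength e m (c *: p).
Proof.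
elim=> {m p} [m|m u v g h p u0 v0 uv hg hh _ IH].
  by rewrite scaler0; apply: low_strength0.
rewrite scalerDr scalerAl.
by apply: (low_strengthS u0 v0 uv _ hh IH); apply: rpredZ.
Qed.

Lemma low_strength_sum e k (I : finType) (P : pred I) (F : I -> {mpoly A[n]}) :
    (forall i, P i -> low_strength e k (F i)) ->
  low_strength e (#|I| * k) (\sum_(i | P i) F i).
Proof.
move=> lF; have : low_strength e (#|P| * k) (\sum_(i | P i) F i).
  rewrite -sum1_card big_distrl /=.
  apply: (big_ind2 (low_strength e)) => [||i Pi].
  - exact: low_strength0.
  - by move=> *; apply: low_strengthD.
  - by rewrite mul1n; apply: lF.
by apply: low_strength_leq; rewrite leq_mul2r max_card orbT.
Qed.

Lemma low_strength_morph (B : nzRingType) n'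
    (r : {rmorphism {mpoly A[n]} -> {mpoly B[n']}}) e m p :
    (forall u g, g \is u.-homog -> r g \is u.-homog) ->
  low_strength e m p -> low_strength e m (r p).
Proof.
move=> rh; elim=> {m p} [m|m u v g h p u0 v0 uv hg hh _ IH].
  by rewrite rmorph0; apply: low_strength0.
rewrite rmorphD rmorphM /=.
by apply: (low_strengthS u0 v0 uv _ _ IH); apply: rh.
Qed.

End LowStrength.

(** * Directional derivatives and specialization of parameters *)

Section DirectionalDerivative.
Variables (T : comNzRingType) (n : nat) (t : 'I_n -> T).
Implicit Types p q : {mpoly T[n]}.

Definition dir_deriv p : {mpoly T[n]} := \sum_j t j *: mderiv j p.

Lemma dir_deriv_is_additive : additive dir_deriv.
Proof.
move=> p q; rewrite /dir_deriv -sumrB; apply: eq_bigr => j _.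
by rewrite raddfB scalerBr.
Qed.
HB.instance Definition _ := GRing.isAdditive.Build _ _ dir_deriv
  dir_deriv_is_additive.

Lemma dir_derivM p q : dir_deriv (p * q) = dir_deriv p * q + p * dir_deriv q.
Proof.
rewrite /dir_deriv mulr_suml mulr_sumr -big_split; apply: eq_bigr => j _ /=.
by rewrite mderivM scalerDr scalerAl scalerAr.
Qed.

Lemma mderiv_dir_deriv j p : mderiv j (dir_deriv p) = dir_deriv (mderiv j p).
Proof.
rewrite /dir_deriv raddf_sum; apply: eq_bigr => k _ /=.
by rewrite mderivZ mderiv_comm.
Qed.

Lemma dir_deriv_dhomog e p : p \is e.-homog -> dir_deriv p \is e.-1.-homog.
Proof.
move=> hp; rewrite /dir_deriv rpred_sum // => j _.
by rewrite rpredZ // mderiv_dhomog.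
Qed.

End DirectionalDerivative.

(** Here p is a polynomial in x over A[t], and t is specialized to a point v
    of A^n. The operator [spec_deriv] is the derivative of p with respect to
    t, in the direction x, at t = v: it raises the degree in x by one. *)
Section Specialization.
Variables (A : comNzRingType) (n : nat).
Notation T := {mpoly A[n]}.

Variable v : 'I_n -> A.

Definition spec_mpoly : {mpoly T[n]} -> {mpoly A[n]} := map_mpoly (meval v).
HB.instance Definition _ := GRing.RMorphism.on spec_mpoly.

Definition spec_deriv (p : {mpoly T[n]}) : {mpoly A[n]} :=
  \sum_j 'X_j * map_mpoly (meval v \o mderiv j) p.

Lemma spec_deriv_is_additive : additive spec_deriv.
Proof.
move=> p q; rewrite /spec_deriv -sumrB; apply: eq_bigr => j _.
by rewrite raddfB mulrBr.
Qed.
HB.instance Definition _ := GRing.isAdditive.Build _ _ spec_deriv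
  spec_deriv_is_additive.

Lemma spec_derivM p q :
  spec_deriv (p * q) =
    spec_deriv p * spec_mpoly q + spec_mpoly p * spec_deriv q.
Proof.
rewrite /spec_deriv mulr_suml mulr_sumr -big_split; apply: eq_bigr => j _ /=.
rewrite mulrCA -mulrA -mulrDr; congr (_ * _).
apply/mpolyP => m; rewrite mcoeffD !mcoeffM mcoeff_map_mpoly mcoeffM raddf_sum.
rewrite -big_split; apply: eq_bigr => k _ /=.
by rewrite !mcoeff_map_mpoly /= mderivM mevalD !mevalM.
Qed.

Lemma spec_deriv_dhomog e p : p \is e.-homog -> spec_deriv p \is e.+1.-homog.
Proof.
move=> hp; rewrite /spec_deriv rpred_sum // => j _; rewrite -add1n.
by apply: dhomogM; [rewrite dhomogX; apply/eqP/mdeg1 | apply: map_mpoly_dhomog].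
Qed.

Lemma spec_mpoly_lift p : spec_mpoly (map_mpoly (@mpolyC n A) p) = p.
Proof.
by apply/mpolyP => m; rewrite !mcoeff_map_mpoly /= mevalC.
Qed.

Lemma spec_deriv_lift p : spec_deriv (map_mpoly (@mpolyC n A) p) = 0.
Proof.
rewrite /spec_deriv big1 // => j _; apply/mpolyP => m.
rewrite (_ : map_mpoly _ _ = 0) ?mulr0 //; apply/mpolyP => k.
by rewrite !mcoeff_map_mpoly /= mderivC meval0 mcoeff0.
Qed.

(** The derivative at v, in the direction x, of a coefficient b in A[t]. *)
Definition spec_linear (b : T) : {mpoly A[n]} :=
  \sum_j (mderiv j b).@[v] *: 'X_j.

Lemma spec_linear_dhomog b : spec_linear b \is 1.-homog.
Proof.
rewrite /spec_linear rpred_sum // => j _; rewrite rpredZ // dhomogX.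
exact/eqP/mdeg1.
Qed.

Lemma spec_derivZ b p :
  spec_deriv (b *: p) = spec_linear b * spec_mpoly p + b.@[v] *: spec_deriv p.
Proof.
rewrite -[b *: p]mul_mpolyC spec_derivM /spec_mpoly map_mpolyC mul_mpolyC.
congr (_ * _ + _); rewrite /spec_deriv /spec_linear; apply: eq_bigr => j _.
by rewrite map_mpolyC /= mulrC mul_mpolyC.
Qed.

(** The only place where differentiating in t does not produce a product:
    the derivative of the linear form t_j in the direction x is x_j, so the
    generic derivative of p becomes sum_j x_j del_j p, and Euler's identity
    applies. *)
Lemma spec_generic_deriv p e : p \is e.-homog ->
  spec_deriv (dir_deriv (fun j => 'X_j) (map_mpoly (@mpolyC n A) p)) =
    e%:R *: p.
Proof.
move=> hp; rewrite -euler_mpoly // /dir_deriv raddf_sum /=.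
apply: eq_bigr => j _; rewrite mderiv_map_mpoly spec_derivZ spec_deriv_lift.
rewrite scaler0 addr0 spec_mpoly_lift; congr (_ * _).
rewrite /spec_linear (bigD1 j) //= big1 ?addr0 => [|i ij].
  have -> : mderiv j 'X_j = 1 :> T.
    rewrite mderivX mnm1E eqxx scale1r (_ : (_ - _ = 0)%MM) ?mpolyX0 //.
    by apply/mnmP => k; rewrite mnmBE subnn mnm0E.
  by rewrite meval1 scale1r.
by rewrite mderivX mnm1E eq_sym (negbTE ij) scale0r meval0 scale0r.
Qed.

Lemma low_strength_spec e m p :
  low_strength e m p -> low_strength e m (spec_mpoly p).
Proof. by apply: low_strength_morph => u g; apply: map_mpoly_dhomog. Qed.

(** The product rule turns each product into two. *)
Lemma low_strength_spec_deriv e m p :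
  low_strength e m p -> low_strength e.+1 (m.*2) (spec_deriv p).
Proof.
elim=> {m p} [m|m u w g h p u0 w0 uw hg hh _ IH].
  by rewrite raddf0; apply: low_strength0.
rewrite raddfD /= spec_derivM -addrA doubleS.
apply: (low_strengthS _ w0 _ (spec_deriv_dhomog hg)); rewrite ?addSn ?uw //.
  exact: map_mpoly_dhomog.
apply: (low_strengthS u0 _ _ _ (spec_deriv_dhomog hh)); rewrite ?addnS ?uw //.
exact: map_mpoly_dhomog.
Qed.

End Specialization.

(** * Jacobian syzygies *)

(** A syzygy common to all columns of the Jacobian matrix. Forms of degree 0
    are placeholders: they have zero derivatives, so the coefficient of at
    least one form of positive degree is required to be nonzero. This allows
    forms to be discarded without changing the index type. *)
Definition jacobian_dep (A : nzRingType) n (I : finType) (d : I -> nat)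
    (f : I -> {mpoly A[n]}) : Prop :=
  exists2 g : I -> {mpoly A[n]},
    (exists2 i, (0 < d i)%N & g i != 0) &
    forall j, \sum_i g i * mderiv j (f i) = 0.

(** A nontrivial combination of forms of one degree e > 0, which therefore
    does not involve the placeholders of degree 0. *)
Definition low_combination (A : nzRingType) n (I : finType) (d : I -> nat)
    (f : I -> {mpoly A[n]}) (m : nat) : Prop :=
  exists e (a : I -> A),
    [/\ (0 < e)%N, exists2 i, d i = e & a i != 0
      & low_strength e m (\sum_(i | d i == e) a i *: f i)].

Lemma low_combination_leq (A : comNzRingType) n (I : finType) (d : I -> nat)
    (f : I -> {mpoly A[n]}) m m' :
  (m <= m')%N -> low_combination d f m -> low_combination d f m'.
Proof.
move=> lem [e [a [e0 ea la]]]; exists e, a; split=> //.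
exact: low_strength_leq la.
Qed.

(** With h' the derivative of h and g' that of g, this eliminates h c
    between a linear relation and its derivative: the factor of h i at i = c
    is g c * g' c - g' c * g c = 0. *)
Lemma eliminate_relation (S : comNzRingType) (I : finType) (c : I)
    (g g' h h' : I -> S) :
    \sum_i g i * h i = 0 -> \sum_i (g' i * h i + g i * h' i) = 0 ->
  \sum_i (if i == c then 0 else g c * g' i - g' c * g i) * h i +
    \sum_i g c * g i * h' i = 0.
Proof.
move=> gh gh'.
transitivity (g c * \sum_i (g' i * h i + g i * h' i) - g' c * \sum_i g i * h i).
  rewrite !mulr_sumr -sumrB -big_split /=; apply: eq_bigr => i _.
  rewrite mulrDr addrAC !mulrA -mulrBl; congr (_ * _ + _).
  by case: eqP => [->|//]; rewrite [g' c * _]mulrC subrr.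
by rewrite gh gh' !mulr0 subr0.
Qed.

(** The family f with f c removed (replaced by a placeholder) and all the
    derivatives of the f i in the direction t adjoined, over an extension T
    of A that contains the coordinates of t. *)
Section Replace.
Variables (A T : idomainType) (iota : {rmorphism A -> T}) (n : nat).
Variables (t : 'I_n -> T) (I : finType) (d : I -> nat).
Variables (f : I -> {mpoly A[n]}) (c : I).

Definition replaced_degree (x : I + I) : nat :=
  match x with inl i => if i == c then 0 else d i | inr i => (d i).-1 end.

Definition replaced_form (x : I + I) : {mpoly T[n]} :=
  match x with
  | inl i => if i == c then 0 else map_mpoly iota (f i)
  | inr i => dir_deriv t (map_mpoly iota (f i))
  end.

Lemma replaced_form_dhomog : (forall i, f i \is (d i).-homog) ->
  forall x, replaced_form x \is (replaced_degree x).-homog.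
Proof.
move=> hf [] i /=.
  by case: eqP => _; [exact: rpred0 | exact: map_mpoly_dhomog].
by apply/dir_deriv_dhomog/map_mpoly_dhomog.
Qed.

(** The new syzygy is nontrivial because the coefficient of the derivative
    of f c is the square of that of f c, and that derivative has positive
    degree. *)
Lemma jacobian_dep_replaced (g : I -> {mpoly A[n]}) : injective iota ->
    (forall j, \sum_i g i * mderiv j (f i) = 0) -> g c != 0 -> (1 < d c)%N ->
  jacobian_dep replaced_degree replaced_form.
Proof.
move=> inj gf gc dc; pose G i := map_mpoly iota (g i).
have Gc : G c != 0.
  apply: contraNneq gc => /mpolyP Gc0; apply/eqP/mpolyP => m; apply: inj.
  by rewrite -mcoeff_map_mpoly Gc0 !mcoeff0 rmorph0.
(* The two groups of coefficients come from [eliminate_relation]. *)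
exists (fun x => match x with
  | inl i => if i == c then 0
             else G c * dir_deriv t (G i) - dir_deriv t (G c) * G i
  | inr i => G c * G i end).
  exists (inr c) => /=; first by rewrite -subn1 subn_gt0.
  exact: mulf_neq0.
move=> j; rewrite big_sumType /=.
have rel : \sum_i G i * mderiv j (map_mpoly iota (f i)) = 0.
  transitivity (map_mpoly iota (\sum_i g i * mderiv j (f i))); last first.
    by rewrite gf rmorph0.
  rewrite rmorph_sum /=; apply: eq_bigr => i _.
  by rewrite rmorphM /= -mderiv_map_mpoly.
have Drel : \sum_i (dir_deriv t (G i) * mderiv j (map_mpoly iota (f i)) +
    G i * mderiv j (dir_deriv t (map_mpoly iota (f i)))) = 0.
  transitivity (dir_deriv t (\sum_i G i * mderiv j (map_mpoly iota (f i)))).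
    rewrite raddf_sum /=; apply: eq_bigr => i _.
    by rewrite dir_derivM mderiv_dir_deriv.
  by rewrite rel raddf0.
rewrite -[RHS](eliminate_relation c rel Drel); congr (_ + _).
by apply: eq_bigr => i _; case: eqP => _; rewrite ?mul0r.
Qed.

End Replace.

(** Returning from A[t] to A. The point v is chosen so that one coefficient
    of the given combination S of degree e survives at v. If a derivative D
    f_i survives, the derivative of S in the direction x has degree e+1 and
    equals e+1 times a combination of the f_i, up to products of a linear
    form and a form, at most two for each index. Otherwise S at t = v is
    already a combination of the f_i. *)
Lemma low_combination_replaced (A : idomainType) n (I : finType) (d : I -> nat)
    (f : I -> {mpoly A[n]}) c m :
    [pchar A] =i pred0 -> (forall i, f i \is (d i).-homog) ->
    low_combination (replaced_degree d c)
      (replaced_form (@mpolyC n A) (fun j => 'X_j) f c) m ->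
  low_combination d f (m.*2 + #|I|.*2).
Proof.
move=> A0 hf [e [a [e0 [x xe ax] la]]].
have [v av] := mpoly_neq0_eval A0 ax.
move: la; rewrite big_sumType /=.
set Sl := (X in X + _); set Sr := (X in Sl + X).
(* Since e > 0, this also holds for the placeholders, of degree d i = 0. *)
have Epred i : ((d i).-1 == e) = (d i == e.+1).
  by case: (d i) => [|k] //=; case: (e) e0.
move=> la.
have [/existsP [i /andP [/eqP ie bi]] | b0] :=
    boolP [exists i, (d i == e.+1) && ((a (inr i)).@[v] != 0)].
  exists e.+1, (fun i => (a (inr i)).@[v] * e.+1%:R); split => //.
    exists i => //; rewrite mulf_neq0 // pchar0_natr_eq0 //.
  pose Ll := \sum_(i | (if i == c then 0 else d i) == e)
    spec_linear v (a (inl i)) * (if i == c then 0 else f i).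
  pose Lr := \sum_(i | (d i).-1 == e) spec_linear v (a (inr i)) *
    spec_mpoly v (dir_deriv (fun j => 'X_j) (map_mpoly (@mpolyC n A) (f i))).
  have -> : \sum_(i | d i == e.+1) ((a (inr i)).@[v] * e.+1%:R) *: f i =
      spec_deriv v (Sl + Sr) + ((-1) *: Ll + (-1) *: Lr).
    have -> : spec_deriv v (Sl + Sr) = Ll + (Lr +
        \sum_(i | d i == e.+1) ((a (inr i)).@[v] * e.+1%:R) *: f i).
      rewrite raddfD /= /Sl /Sr !raddf_sum /=; congr (_ + _).
        apply: eq_bigr => k _; rewrite spec_derivZ.
        case: eqP => _; first by rewrite rmorph0 raddf0 !mulr0 scaler0 addr0.
        by rewrite spec_mpoly_lift spec_deriv_lift scaler0 addr0.
      under [in RHS]eq_bigl do rewrite -Epred.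
      rewrite -big_split /=; apply: eq_bigr => k; rewrite Epred => /eqP ke.
      by rewrite spec_derivZ (spec_generic_deriv _ (hf k)) ke scalerA.
    by rewrite !scaleN1r -opprD [RHS]addrC [Ll + (Lr + _)]addrA addKr.
  rewrite -[#|I|.*2]addnn -[#|I|]muln1.
  apply: low_strengthD; first exact: low_strength_spec_deriv.
  apply: low_strengthD; apply: low_strengthZ;
    apply: low_strength_sum => k /eqP ke.
    apply: (low_strengthM (u := 1) (v := e)) => //.
      exact: spec_linear_dhomog.
    by rewrite -ke; case: eqP => // _; apply: rpred0.
  apply: (low_strengthM (u := 1) (v := e)) => //.
    exact: spec_linear_dhomog.
  rewrite -ke; apply: map_mpoly_dhomog; apply: dir_deriv_dhomog.
  exact: map_mpoly_dhomog.
apply: (@low_combination_leq _ _ _ _ _ m).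
  by rewrite -addnn -addnA leq_addr.
exists e, (fun i => if i == c then 0 else (a (inl i)).@[v]); split => //.
  move: x xe ax av => [] i /= ie ax av; last first.
    case/negP: b0; apply/existsP; exists i; rewrite av andbT.
    by rewrite -Epred ie.
  move: ie; case: (i =P c) => [_ ie|/eqP/negbTE ic ie].
    by rewrite -ie in e0.
  by exists i => //; rewrite ic.
have /= := low_strength_spec v la.
rewrite raddfD /= [X in _ + X](_ : _ = 0) ?addr0.
  congr (low_strength _ _ _).
  rewrite raddf_sum /= big_mkcond [RHS]big_mkcond /=.
  apply: eq_bigr => i _; case: (i =P c) => [_|_].
    by rewrite scaler0 raddf0 scale0r !if_same.
  case: ifP => // _.
  by rewrite /spec_mpoly map_mpolyZ /= [map_mpoly _ _]spec_mpoly_lift.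
rewrite raddf_sum big1 // => i; rewrite Epred => ie /=.
have bi : (a (inr i)).@[v] = 0.
  apply/eqP; apply: contraNT b0 => bi; apply/existsP.
  by exists i; rewrite ie.
by rewrite /spec_mpoly map_mpolyZ /= bi scale0r.
Qed.

(** * Dependent forms have a combination of low strength *)

Lemma dhomog0_const (A : nzRingType) n (p : {mpoly A[n]}) :
  p \is 0.-homog -> p = (p@_0%MM)%:MP.
Proof.
move=> hp; apply/mpolyP => m; rewrite mcoeffC.
have [->|m0] := eqVneq m 0%MM; first by rewrite mulr1.
by rewrite mulr0 (dhomog_nemf_coeff hp) //= mdeg_eq0.
Qed.

(** For linear forms the derivatives are constants, so one coefficient of
    the syzygy, at a monomial of some g c <> 0, is a nontrivial linear
    relation between the forms. *)
Lemma low_combination_linear (A : idomainType) n (I : finType) (d : I -> nat)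
    (f : I -> {mpoly A[n]}) :
    (forall i, f i \is (d i).-homog) -> (forall i, (d i <= 1)%N) ->
  jacobian_dep d f -> low_combination d f 0.
Proof.
move=> hf d1 [g [c dc gc] gf].
have /mpolyP/existsNP [mu gmu] : g c <> 0 by apply/eqP.
exists 1%N, (fun i => (g i)@_mu); split => //.
  exists c; first by apply/eqP; rewrite eqn_leq d1 dc.
  by rewrite mcoeff0 in gmu; apply/eqP.
set h := \sum_(i | _) _.
have hh : h \is 1.-homog.
  by rewrite /h rpred_sum // => i /eqP di; rewrite rpredZ // -di.
suff h0 : forall j, mderiv j h = 0.
  suff -> : h = 0 by apply: low_strength0.
  rewrite -[h]scale1r -(euler_mpoly hh) big1 // => j _.
  by rewrite h0 mulr0.
move=> j; pose cf i := (mderiv j (f i))@_0%MM.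
have cfE i : mderiv j (f i) = (cf i)%:MP.
  apply: dhomog0_const; have := mderiv_dhomog j (hf i).
  by move: (d1 i); case: (d i) => [|[|]].
rewrite /h raddf_sum /=.
transitivity (((\sum_i (g i * mderiv j (f i)))@_mu)%:MP : {mpoly A[n]});
  last by rewrite gf mcoeff0 mpolyC0.
rewrite raddf_sum rmorph_sum /= big_mkcond /=; apply: eq_bigr => i _.
rewrite cfE [g i * _]mulrC mcoeffCM; case: eqP => di.
  by rewrite mderivZ cfE -mul_mpolyC -rmorphM mulrC.
suff -> : cf i = 0 by rewrite mul0r mpolyC0.
have {}di : d i = 0%N by move: (d1 i) di; case: (d i) => [|[|]].
rewrite /cf [f i]dhomog0_const ?mderivC ?mcoeff0 //.
by have := hf i; rewrite di.
Qed.

(** Forms of degree D may be turned into placeholders: since a combination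
    lives in one degree, the combinations found afterwards are in degrees
    other than D. *)
Lemma low_combination_drop (A : idomainType) n (I : finType) (d : I -> nat)
    (f : I -> {mpoly A[n]}) D m :
    low_combination (fun i => if d i == D then 0%N else d i)
      (fun i => if d i == D then 0 else f i) m ->
  low_combination d f m.
Proof.
move=> [e [a [e0 [i0 ie ai0] la]]].
have [eD di0] : e != D /\ d i0 = e.
  move: ie; case: (d i0 =P D) => [_ ie|/eqP dD <-]; last by [].
  by rewrite -ie in e0.
exists e, a; split => //; first by exists i0.
have -> // : \sum_(i | d i == e) a i *: f i =
  \sum_(i | (if d i == D then 0%N else d i) == e)
     a i *: (if d i == D then 0 else f i).
rewrite big_mkcond [RHS]big_mkcond; apply: eq_bigr => i _.
case: (d i =P D) => [->|_] //.
by rewrite eq_sym (negbTE eD) eq_sym gtn_eqF.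
Qed.

(** Induction on the maximal degree D and, for fixed D, on the number k of
    forms of degree D; the number r of all forms doubles at each
    replacement, so it has to be arbitrary in the induction hypothesis.
    Quantifying over A inside the bound is what permits the passage from A
    to A[t]. *)
Lemma jacobian_dep_low_combination D k r : exists m,
  forall (A : idomainType) n (I : finType) (d : I -> nat)
      (f : I -> {mpoly A[n]}),
    [pchar A] =i pred0 -> (#|I| <= r)%N -> (forall i, (d i <= D)%N) ->
    (#|[pred i | d i == D]| <= k)%N -> (forall i, f i \is (d i).-homog) ->
  jacobian_dep d f -> low_combination d f m.
Proof.
elim: D k r => [|D IHD] k r.
  exists 0%N => A n I d f _ _ d0 _ _ [g [i di _] _].
  by move: (d0 i) di; case: (d i).
elim: k r => [|k IHk] r; have [m0 H0] := IHD r r.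
  exists m0 => A n I d f A0 Ir dD dk hf [g [i0 di0 gi0] gf].
  have d_neq i : d i != D.+1.
    move: dk; rewrite leqn0 => /eqP/card0_eq/(_ i).
    by rewrite inE => ->.
  apply: H0 => //; last by exists g => //; exists i0.
    by move=> i; have := dD i; rewrite leq_eqVlt (negbTE (d_neq i)).
  by apply: leq_trans Ir; apply: max_card.
have [m1 H1] := IHk r.*2.
exists (maxn m0 (m1.*2 + r.*2)) => A n I d f A0 Ir dD dk hf [g [i0 di0 gi0] gf].
have [/existsP [c /andP [/eqP dc gc]] | gD] :=
    boolP [exists c, (d c == D.+1) && (g c != 0)]; last first.
  have {}gD i : d i == D.+1 -> g i = 0.
    move=> di; apply/eqP; apply: contraNT gD => gi.
    by apply/existsP; exists i; rewrite di.
  apply: (low_combination_leq (leq_maxl _ _)).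
  apply: (@low_combination_drop _ _ _ _ _ D.+1); apply: H0 => //.
  - by move=> i; have := dD i; rewrite leq_eqVlt; case: eqP.
  - by apply: leq_trans Ir; apply: max_card.
  - by move=> i; case: eqP => // _; apply: rpred0.
  exists g.
    exists i0 => //; case: eqP => // /eqP /gD g0.
    by rewrite g0 eqxx in gi0.
  move=> j; rewrite -[RHS](gf j); apply: eq_bigr => i _.
  by case: eqP => // /eqP /gD ->; rewrite !mul0r.
(* If the top degree is 1, derivatives are constants and cannot replace f c. *)
case: D IHD IHk m0 H0 m1 H1 dD dk dc gc => [|D] _ _ m0 _ m1 H1 dD dk dc gc.
  apply: (low_combination_leq (leq0n _)).
  by apply: low_combination_linear => //; exists g => //; exists i0.
apply: (low_combination_leq (m := m1.*2 + #|I|.*2)).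
  by rewrite leq_max leq_add2l leq_double Ir orbT.
apply: (low_combination_replaced (c := c)) => //.
apply: H1 => //.
- exact: mpoly_pchar0.
- by rewrite card_sum addnn leq_double.
- case=> i /=; first by case: eqP.
  by rewrite -subn1 leq_subLR add1n (leq_trans (dD i)).
- rewrite -sum1_card big_sumType /= [X in (_ + X)%N]big_pred0 => [|i];
    last first.
    rewrite inE /=; apply/negbTE; rewrite neq_ltn.
    by rewrite (_ : _ < _)%N //; move: (dD i); case: (d i).
  rewrite addn0 -ltnS; apply: leq_trans dk.
  rewrite -[X in (_ < X)%N]sum1_card [X in (_ < X)%N](bigD1 c) /= ?inE ?dc //.
  rewrite add1n ltnS.
  rewrite leq_eqVlt; apply/orP; left; apply/eqP; apply: eq_bigl => i.
  by rewrite !inE /=; case: (i =P c) => [->|_]; rewrite ?andbT ?andbF.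
- exact: replaced_form_dhomog.
apply: (jacobian_dep_replaced _ _ gf gc); last by rewrite dc.
by move=> x y /(congr1 (mcoeff 0%MM)); rewrite !mcoeffC eqxx !mulr1.
Qed.

(** * Algebraic relations and powers of linear forms *)

Lemma mmap_comp (A : nzRingType) (S S' : comNzRingType) n (f : A -> S)
    (h : 'I_n -> S) (r : {rmorphism S -> S'}) (p : {mpoly A[n]}) :
  r (mmap f h p) = mmap (r \o f) (r \o h) p.
Proof.
rewrite /mmap rmorph_sum; apply: eq_bigr => m _ /=.
rewrite rmorphM /mmap1 rmorph_prod; congr (_ * _); apply: eq_bigr => i _ /=.
by rewrite rmorphXn.
Qed.

Lemma eq_mmap (A : nzRingType) (S : comNzRingType) n (f f' : A -> S)
    (h h' : 'I_n -> S) (p : {mpoly A[n]}) :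
  f =1 f' -> h =1 h' -> mmap f h p = mmap f' h' p.
Proof.
move=> ef eh; apply: eq_bigr => m _; rewrite ef /mmap1; congr (_ * _).
by apply: eq_bigr => i _; rewrite eh.
Qed.

Lemma mmap_homog_scale (A : nzRingType) (S : comNzRingType) n (f : A -> S)
    (h : 'I_n -> S) y e (p : {mpoly A[n]}) :
  p \is e.-homog -> mmap f (fun k => h k * y) p = mmap f h p * y ^+ e.
Proof.
move=> /dhomogP hp; rewrite /mmap mulr_suml; apply: eq_big_seq => m mp.
have <- : mdeg m = e by exact: hp.
rewrite -mulrA; congr (_ * _); rewrite /mmap1 mdegE expr_sum -big_split.
by apply: eq_bigr => i _ /=; rewrite exprMn.
Qed.

Lemma mmap_linear_dhomog (A : comNzRingType) n n' (h : 'I_n -> {mpoly A[n']})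
    e (p : {mpoly A[n]}) :
  (forall k, h k \is 1.-homog) -> p \is e.-homog ->
  mmap (@mpolyC n' A) h p \is e.-homog.
Proof.
move=> hh /dhomogP hp; rewrite /mmap big_seq rpred_sum // => m mp.
rewrite mul_mpolyC rpredZ //; have <- : mdeg m = e by exact: hp.
rewrite /mmap1 mdegE.
apply: (big_rec2 (fun (q : {mpoly A[n']}) k => q \is k.-homog)).
  exact: dhomog1.
move=> i q k _ hq; apply: dhomogM => //.
by have := dhomogMn (m i) (hh i); rewrite mul1n.
Qed.

(** For a relation Q of least degree some partial derivative of Q is not a
    relation, as otherwise all of them would be zero and Q constant. The
    values of these partial derivatives at F are the coefficients of the
    syzygy. *)
Lemma jacobian_of_algebraic_dep (A : idomainType) n (I : finType)
    (F : I -> {mpoly A[n]}) (Q : {mpoly A[#|I|]}) :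
    [pchar A] =i pred0 -> Q != 0 ->
    mmap (@mpolyC n A) (fun k : 'I_#|I| => F (enum_val k)) Q = 0 ->
  exists2 g : I -> {mpoly A[n]}, (exists i, g i != 0) &
    forall j, \sum_i g i * mderiv j (F i) = 0.
Proof.
move=> A0 Qn0 QF; apply: contrapT => noG.
pose ev := mmap (@mpolyC n A) (fun k : 'I_#|I| => F (enum_val k)).
suff H k : forall q : {mpoly A[#|I|]}, (msize q <= k)%N -> ev q = 0 -> q = 0.
  by move: Qn0; rewrite (H _ Q (leqnn _) QF) eqxx.
elim: k => [|k IH] q qk qF; first by apply/eqP; rewrite -msize_poly_eq0 -leqn0.
have dq i : mderiv i q = 0.
  apply: (IH _ (msize_mderiv i qk)); apply/eqP; apply: contraT => dq.
  case: noG; exists (fun x => ev (mderiv (enum_rank x) q)).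
    by exists (enum_val i); rewrite enum_valK.
  move=> j; have := @mmap_chain_rule _ _ _ (@mpolyC n A)
    (fun k : 'I_#|I| => F (enum_val k)) (mderiv j) q
    (@mderivM _ _ j) (@mderivC _ _ j).
  rewrite -/(ev q) qF raddf0 => /esym dq0.
  rewrite -[RHS]dq0 (reindex (@enum_val I I)) /=;
    last exact/onW_bij/enum_val_bij.
  by apply: eq_bigr => l _; rewrite enum_valK.
have qC := mderiv_eq0_const A0 dq.
move: qF; rewrite qC /ev mmapC => /eqP; rewrite mpolyC_eq0 => /eqP ->.
by rewrite mpolyC0.
Qed.

(** The scalar b is a multinomial coefficient, hence nonzero in
    characteristic zero. It is obtained by induction on e, from the identity
    del_j (l ^ (e+1)) = (e+1) x_j l ^ e, as only b <> 0 matters. *)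
Lemma power_linear_coeff (K : fieldType) n e (al : 'X_{1..n}) :
    [pchar K] =i pred0 -> mdeg al = e ->
  exists2 b : K, b != 0 & forall x : 'I_n -> K,
    ((\sum_j x j *: 'X_j : {mpoly K[n]}) ^+ e)@_al = b * \prod_j x j ^+ al j.
Proof.
move=> K0; elim: e al => [|e IH] al ale.
  exists 1; first exact: oner_neq0.
  move=> x; have -> : al = 0%MM by apply/eqP; rewrite -mdeg_eq0 ale.
  by rewrite expr0 mcoeff1 eqxx mul1r big1 // => j _; rewrite mnm0E.
have [j aj] : exists j, al j != 0%N.
  apply/existsP; apply: contra_eqT ale; rewrite negb_exists => /forallP al0.
  by rewrite mdegE big1 // => j _; apply/eqP; have := al0 j; rewrite negbK.
have Uj : (al - U_(j) + U_(j))%MM = al by rewrite submK // lep1mP.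
have [|b b0 Hb] := IH (al - U_(j))%MM.
  by move: ale; rewrite -{1}Uj mdegD mdeg1 addn1 => -[].
have ajK : (al j)%:R != 0 :> K by rewrite pchar0_natr_eq0.
exists (e.+1%:R * b / (al j)%:R).
  by rewrite !mulf_neq0 ?invr_eq0 ?pchar0_natr_eq0.
move=> x; set l := \sum_j _.
have dl : mderiv j l = (x j)%:MP.
  rewrite /l raddf_sum /= (bigD1 j) //= big1 => [|i ij].
    rewrite mderivZ mderivX mnm1E eqxx scale1r (_ : (_ - _ = 0)%MM).
      by rewrite mpolyX0 -mul_mpolyC mulr1 addr0.
    by apply/mnmP => k; rewrite mnmBE subnn mnm0E.
  by rewrite mderivZ mderivX mnm1E (negbTE ij) scale0r scaler0.
have dle k : mderiv j (l ^+ k.+1) = (k.+1%:R * x j) *: l ^+ k.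
  elim: k => [|k IHk]; first by rewrite expr1 expr0 dl mul1r -mul_mpolyC mulr1.
  rewrite exprS mderivM dl IHk mul_mpolyC -scalerAr -exprS -scalerDl.
  by rewrite -{1}[x j]mul1r -mulrDl nat1r.
have := congr1 (mcoeff (al - U_(j))%MM) (dle e).
rewrite mcoeff_deriv Uj mcoeffZ Hb mnmBE mnm1E eqxx subn1 prednK ?lt0n //.
move=> Hc; apply: (mulIf ajK); rewrite mulr_natr Hc.
rewrite [RHS]mulrAC divfK // -!mulrA; congr (_ * _).
rewrite mulrCA; congr (_ * _).
rewrite (bigD1 j) //= [in RHS](bigD1 j) //= mulrA.
rewrite mnmBE mnm1E eqxx -exprS subn1 prednK ?lt0n //; congr (_ * _).
by apply: eq_bigr => i ij; rewrite mnmBE mnm1E eq_sym (negbTE ij) subn0.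
Qed.

(** * The section by a generic plane *)

Section GenericSection.
Variables (K : fieldType) (N n : nat).
Local Notation T := {mpoly K[N.+1 * n.+1]}.

Definition generic_pullback (p : {mpoly K[N.+1]}) : {mpoly T[n.+1]} :=
  mmap (@mpolyC n.+1 T \o @mpolyC (N.+1 * n.+1) K)
    (fun k => \sum_j ('X_(mxvec_index k j) : T) *: 'X_j) p.

Lemma map_generic_pullback (S : comNzRingType) (r : {rmorphism T -> S}) p :
  map_mpoly r (generic_pullback p) =
  mmap (@mpolyC n.+1 S \o (r \o @mpolyC (N.+1 * n.+1) K))
    (fun k => \sum_j r 'X_(mxvec_index k j) *: 'X_j) p.
Proof.
rewrite mmap_comp; apply: eq_mmap => [b|k] /=; first by rewrite map_mpolyC.
rewrite raddf_sum; apply: eq_bigr => j _ /=.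
by rewrite map_mpolyZ map_mpolyX.
Qed.

Lemma generic_pullback_eval (M : 'M[K]_(N.+1, n.+1)) p al :
  ((generic_pullback p)@_al).@[fun k => mxvec M 0 k] = (pullback_mpoly M p)@_al.
Proof.
rewrite -(mcoeff_map_mpoly (meval _)) map_generic_pullback; congr (_@__).
apply: eq_mmap => [b|k] /=; first by rewrite mevalC.
by rewrite tnth_mktuple; apply: eq_bigr => j _; rewrite mevalXU mxvecE.
Qed.

(** Y_kj := v_k x_j, with the v_k the variables of the target ring. *)
Definition rank_one_subst (x : 'I_n.+1 -> K) : T -> {mpoly K[N.+1]} :=
  mmap (@mpolyC N.+1 K) (fun k => mxvec (\matrix_(i, j) (x j *: 'X_i)) 0 k).
HB.instance Definition _ x := GRing.RMorphism.on (rank_one_subst x).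

Lemma rank_one_subst_dhomog x e p :
  p \is e.-homog -> rank_one_subst x p \is e.-homog.
Proof.
apply: mmap_linear_dhomog => k; case/mxvec_indexP: k => i j.
by rewrite mxvecE mxE rpredZ // dhomogX; apply/eqP/mdeg1.
Qed.

(** At the matrix v x^T the form p(Y X) becomes p(v l) = l^e p(v), where l
    is the linear form sum_j x_j X_j. *)
Lemma rank_one_subst_pullback x e p al : p \is e.-homog ->
  rank_one_subst x (generic_pullback p)@_al =
  ((\sum_j x j *: 'X_j : {mpoly K[n.+1]}) ^+ e)@_al *: p.
Proof.
move=> hp; rewrite -(mcoeff_map_mpoly (rank_one_subst x)) map_generic_pullback.
pose l : {mpoly K[n.+1]} := \sum_j x j *: 'X_j.
pose L := map_mpoly (@mpolyC N.+1 K) l.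
rewrite (eq_mmap (f' := @mpolyC n.+1 _ \o @mpolyC N.+1 K)
  (h' := fun k => ('X_k)%:MP * L)) => [|b|k]; last 2 first.
- by rewrite /= /rank_one_subst mmapC.
- rewrite /L /l raddf_sum mulr_sumr; apply: eq_bigr => j _ /=.
  rewrite map_mpolyZ map_mpolyX /rank_one_subst mmapX mmap1U mxvecE mxE.
  by rewrite mul_mpolyC scalerA -[x j *: 'X_k]mul_mpolyC mulrC.
rewrite (mmap_homog_scale _ _ _ hp).
rewrite -(mmap_comp (@mpolyC N.+1 K) (fun k => 'X_k) (@mpolyC n.+1 _)).
have -> : mmap (@mpolyC N.+1 K) (fun k => 'X_k) p = p.
  by rewrite [RHS]mpolyE; apply: eq_bigr => m _; rewrite mmap1_id mul_mpolyC.
rewrite mcoeffCM -rmorphXn mcoeff_map_mpoly /= mulrC.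
by rewrite mul_mpolyC.
Qed.

(** Polynomials in x whose coefficients are forms of degree e in Y multiply
    as graded pieces, and each coordinate of Y x is of this kind with e = 1. *)
Lemma generic_pullback_dhomog e p al :
  p \is e.-homog -> (generic_pullback p)@_al \is e.-homog.
Proof.
pose Q e (q : {mpoly T[n.+1]}) := forall al, q@_al \is e.-homog.
have QM u v q r : Q u q -> Q v r -> Q (u + v)%N (q * r).
  move=> hq hr m; rewrite mcoeffM rpred_sum // => k _.
  by apply: dhomogM.
have Q1 : Q 0%N 1.
  move=> m; rewrite mcoeff1; case: eqP => _; first exact: dhomog1.
  exact: rpred0.
have QX k : Q 1%N (\sum_j ('X_(mxvec_index k j) : T) *: 'X_j).
  move=> m; rewrite raddf_sum rpred_sum // => j _ /=.
  rewrite mcoeffZ mcoeffX; case: eqP => _; last by rewrite mulr0 rpred0.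
  by rewrite mulr1 dhomogX; apply/eqP/mdeg1.
move=> /dhomogP hp; rewrite /generic_pullback /mmap raddf_sum big_seq.
apply: rpred_sum => m mp /=; rewrite mcoeffCM mul_mpolyC rpredZ //.
have <- : mdeg m = e by exact: hp.
rewrite mdegE; move: al; apply: (big_rec2 (fun q k => Q k q)) => // i q k _ hq.
apply: (QM) => //; elim: (m i) => [|s IH]; first by rewrite expr0.
by rewrite exprS -add1n; apply: QM.
Qed.

End GenericSection.

(** * Strength, dominance and injective matrices *)

Lemma has_strength_decomp_of_low (K : fieldType) n e m (p : {mpoly K[n]}) :
    low_strength e m p -> p != 0 ->
  exists2 s, (s < m)%N & has_strength_decomp e p s.
Proof.
move=> lp; suff [->|] : p = 0 \/
    exists2 s, (s < m)%N & has_strength_decomp e p s by rewrite ?eqxx.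
elim: lp => {m p} [m|m u v g h p u0 v0 uv hg hh _ IH]; first by left.
have ule : (1 <= u <= e - 1)%N by rewrite u0 -uv -addnBA // leq_addr.
have vle : (1 <= v <= e - 1)%N.
  by rewrite v0 -uv addnC -addnBA // leq_addr.
right; case: IH => [->|[s sm [g' [h' [gh' ->]]]]].
  exists 0%N => //; exists (fun=> g), (fun=> h).
  by split; [move=> _; exists u, v | rewrite big_ord1 addr0].
exists s.+1 => //.
exists (fun i => oapp g' g (unlift ord0 i)).
exists (fun i => oapp h' h (unlift ord0 i)).
split; last first.
  rewrite [RHS]big_ord_recl unlift_none; congr (_ + _).
  by apply: eq_bigr => i _; rewrite liftK.
move=> i; case: unliftP => [j _|_] /=; first exact: gh'.
by exists u, v.
Qed.

Lemma strength_lt_of_low (K : fieldType) n e m (p : {mpoly K[n]}) :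
  p \is e.-homog -> low_strength e m p -> (strength p < m%:Z%:E)%E.
Proof.
move=> hp lp; rewrite /strength; case: eqP => [_|/eqP p0]; first exact: ltNyr.
have ep : (msize p).-1 = e.
  by apply: (dhomog_uniq p0 _ hp); apply: (dhomog_msize hp).
have [s sm ds] := has_strength_decomp_of_low lp p0.
rewrite ep; case: pselect => [ex_s|]; last by case; exists s; apply/asboolP.
case: ex_minnP => k _ /(_ s) kmin.
rewrite lte_fin ltz_nat; apply: leq_ltn_trans sm; apply: kmin.
exact/asboolP.
Qed.

Lemma collective_strength_lt (K : fieldType) n c (d : 'I_c -> nat)
    (f : forall i, dhomog n K (d i)) m k :
    collective_strength_ge f m ->
    low_combination d (fun i => f i : {mpoly K[n]}) k ->
  m < k%:Z.
Proof.
move=> fm [e [a [e0 [i0 die ai0] la]]].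
pose a' i := if d i == e then a i else 0.
have aE : \sum_i a' i *: (f i : {mpoly K[n]}) =
    \sum_(i | d i == e) a i *: (f i : {mpoly K[n]}).
  rewrite [RHS]big_mkcond; apply: eq_bigr => i _.
  by rewrite /a'; case: ifP; rewrite ?scale0r.
have := fm a'; rewrite aE => H.
rewrite -lte_fin; apply: (le_lt_trans (H _ _)).
- by exists i0; rewrite /a' die eqxx.
- by exists e => i; rewrite /a'; case: (d i =P e) => // _; rewrite eqxx.
apply: (strength_lt_of_low (e := e)) => //.
rewrite rpred_sum // => i /eqP <-; rewrite rpredZ //.
exact: (dhomog_is_dhomog (f i)).
Qed.

Lemma dominant_of_polynomial_fun (K : fieldType) c n (d : 'I_c -> nat)
    (U : Type) (u : U -> forms K n d) :
    (forall phi : forms K n d -> K, polynomial_fun phi ->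
       (forall t, phi (u t) = 0) -> forall F, phi F = 0) ->
  dominant u.
Proof.
move=> H; apply/seteqP; split=> // F _ Z [[E EP ->] uZ] phi Ephi.
apply: H; first exact: EP.
by move=> t; apply: uZ => //; exists t.
Qed.

(** Multiply q by the determinant of the top square block of Y: where both
    factors are nonzero the matrix is injective. The product can only be
    zero everywhere if q is, as the determinant is 1 at the matrix with ones
    on its main diagonal. *)
Lemma eq0_of_injective_vanishing (K : fieldType) N n
    (q : {mpoly K[N.+1 * n.+1]}) :
    [pchar K] =i pred0 -> (n <= N)%N ->
    (forall M : 'M[K]_(N.+1, n.+1), injective (fun v : 'cV_n.+1 => M *m v) ->
      q.@[fun k => mxvec M 0 k] = 0) ->
  q = 0.
Proof.
move=> K0 nN qM.
pose top (i : 'I_n.+1) : 'I_N.+1 := widen_ord (nN : (n.+1 <= N.+1)%N) i.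
pose D : {mpoly K[N.+1 * n.+1]} :=
  \det (\matrix_(i, j) 'X_(mxvec_index (top i) j)).
have DE M : D.@[fun k => mxvec M 0 k] = \det (rowsub top M).
  rewrite -det_map_mx; congr (\det _); apply/matrixP => i j.
  by rewrite !mxE /= mevalXU mxvecE.
have D0 : D != 0.
  apply/eqP => D0; have := DE (\matrix_(i, j) (i == j :> nat)%:R).
  rewrite D0 meval0 (_ : rowsub _ _ = 1%:M).
    by rewrite det1 => /esym /eqP; rewrite oner_eq0.
  by apply/matrixP => i j; rewrite !mxE.
apply/eqP; apply: contraT => q0.
have [v] := mpoly_neq0_eval K0 (mulf_neq0 q0 D0).
pose M : 'M[K]_(N.+1, n.+1) := \matrix_(i, j) v (mxvec_index i j).
have vM : v =1 (fun k => mxvec M 0 k).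
  by move=> k; case/mxvec_indexP: k => i j; rewrite mxvecE mxE.
rewrite (meval_eq _ vM) mevalM DE mulf_eq0 negb_or => /andP [qM0 DM].
case/negP: qM0; apply/eqP; apply: qM => w w' /(congr1 (rowsub top)).
rewrite -!mul_rowsub_mx; apply: can_inj (mulmx (invmx (rowsub top M))) _ w w'.
by move=> w; rewrite mulKmx // unitmxE unitfE.
Qed.

(** * Coefficients of plane sections *)

Section Sections.
Variables (K : fieldType) (c n : nat) (d : 'I_c -> nat).
Hypothesis K0 : [pchar K] =i pred0.

(** The pairs (i, al) with |al| = d i. The bound on the degree of al by the
    maximum of d only serves to place the pairs in a finite type. *)
Definition coef_index : finType :=
  {x : 'I_c * 'X_{1..n.+1 < (\max_i d i).+1} | mdeg x.2 == d x.1}.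

Definition coef_form (x : coef_index) : 'I_c := (sval x).1.
Definition coef_mnm (x : coef_index) : 'X_{1..n.+1} := (sval x).2.

Lemma mdeg_coef_mnm x : mdeg (coef_mnm x) = d (coef_form x).
Proof. exact/eqP/(svalP x). Qed.

Lemma coef_index_inj x y :
  coef_form x = coef_form y -> coef_mnm x = coef_mnm y -> x = y.
Proof.
case: x y => [[i al] al_i] [[j be] be_j]; rewrite /coef_form /coef_mnm /=.
move=> ij /val_inj albe; subst j be; congr exist; exact: bool_irrelevance.
Qed.

Lemma sum_coef_index (F : forms K n d) i m :
  (F i)@_m = \sum_(x : coef_index | (coef_form x == i) && (coef_mnm x == m))
    (F (coef_form x))@_(coef_mnm x).
Proof.
have [dm|dm] := eqVneq (mdeg m) (d i); last first.
  rewrite big_pred0 => [|x].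
    exact: (dhomog_nemf_coeff (dhomog_is_dhomog (F i)) dm).
  apply/negP => /andP [/eqP xi /eqP xm]; case/eqP: dm.
  by rewrite -xi -xm mdeg_coef_mnm.
have lm : (mdeg m < (\max_i d i).+1)%N by rewrite ltnS dm leq_bigmax.
pose x0 : coef_index := exist _ (i, BMultinom lm) (introT eqP dm).
have x0P : (fun x => (coef_form x == i) && (coef_mnm x == m)) =1 pred1 x0.
  move=> x; apply/andP/eqP => [[/eqP xi /eqP xm]|->].
    exact: coef_index_inj.
  by split; apply/eqP.
by rewrite (eq_bigl _ _ x0P) big_pred1_eq.
Qed.

(** A polynomial function may use a coordinate repeatedly, or a monomial of
    the wrong degree, whose coefficient is zero; each coordinate is
    therefore written as a sum, over at most one index, of standard
    coordinates. *)
Lemma polynomial_fun_coef (phi : forms K n d -> K) : polynomial_fun phi ->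
  exists Q : {mpoly K[#|coef_index|]}, forall F : forms K n d,
    phi F = Q.@[fun k => (F (coef_form (enum_val k)))@_(coef_mnm (enum_val k))].
Proof.
move=> [k [i [m [P phiE]]]].
exists (mmap (@mpolyC _ K) (fun j =>
  \sum_(x : coef_index | (coef_form x == i j) && (coef_mnm x == m j))
    'X_(enum_rank x)) P) => F.
rewrite phiE (mmap_comp _ _ (meval _)); apply: eq_mmap => [b|j] /=.
  by rewrite mevalC.
rewrite sum_coef_index raddf_sum; apply: eq_bigr => x _ /=.
by rewrite mevalXU enum_rankK.
Qed.

Variables (N : nat) (f : forms K N d).

Definition section_coef (x : coef_index) : {mpoly K[N.+1 * n.+1]} :=
  (generic_pullback n (f (coef_form x)))@_(coef_mnm x).

(** The rank one substitution gives the f_i the coefficients b v i = sum_al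
    a_{i,al} (l_v ^ e)_al, which are polynomials in v. The monomials v^al
    are distinct for fixed i, so one of these polynomials is nonzero. *)
Lemma low_combination_section_coef m :
    low_combination (fun x => d (coef_form x)) section_coef m ->
  low_combination d (fun i => f i : {mpoly K[N.+1]}) m.
Proof.
move=> [e [a [e0 [x0 dx0 ax0] la]]].
pose l x : {mpoly K[n.+1]} := \sum_j x j *: 'X_j.
pose b v i := \sum_(x : coef_index | coef_form x == i)
  a x * (l v ^+ e)@_(coef_mnm x).
have [v bv] : exists v, b v (coef_form x0) != 0.
  (* The multinomial coefficients of all monomials al at once. *)
  have /choice [w wP] (x : coef_index) : exists w : K,
      d (coef_form x) = e -> w != 0 /\
      forall v, (l v ^+ e)@_(coef_mnm x) = w * \prod_j v j ^+ coef_mnm x j.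
    have [de|] := eqVneq (d (coef_form x)) e; last first.
      by move=> /eqP de; exists 0 => /de.
    have [w w0 wP] := power_linear_coeff K0 (etrans (mdeg_coef_mnm x) de).
    by exists w.
  pose p : {mpoly K[n.+1]} := \sum_(x | coef_form x == coef_form x0)
    (a x * w x) *: 'X_[coef_mnm x].
  have p0 : p != 0.
    apply/eqP => /(congr1 (mcoeff (coef_mnm x0))); rewrite raddf_sum mcoeff0.
    rewrite (bigD1 x0) //= big1 ?addr0 => [|x /andP [/eqP xi xx0]].
      rewrite mcoeffZ mcoeffX eqxx mulr1 => /eqP; rewrite mulf_eq0 (negbTE ax0).
      by have [/negbTE -> _] := wP x0 dx0.
    rewrite mcoeffZ mcoeffX; case: eqP => [xm|_]; last by rewrite mulr0.
    by case/eqP: xx0; apply: coef_index_inj.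
  have [v pv] := mpoly_neq0_eval K0 p0; exists v; move: pv.
  rewrite /p raddf_sum /b; congr (_ != _); apply: eq_bigr => x /eqP xi /=.
  by rewrite mevalZ mevalX -mulrA (wP x _).2 // xi.
exists e, (b v); split => //; first by exists (coef_form x0).
have := low_strength_morph (r := rank_one_subst v)
  (fun u g => @rank_one_subst_dhomog _ _ _ v u g) la.
congr (low_strength _ _ _); rewrite raddf_sum /=.
rewrite (partition_big coef_form (fun i => d i == e)) //=.
apply: eq_bigr => i /eqP di; rewrite /b scaler_suml.
apply: eq_big => [x|x /andP [_ /eqP xi]].
  by case: (coef_form x =P i) => [->|_]; rewrite ?andbF // di eqxx.
have hf : (f i : {mpoly K[N.+1]}) \is e.-homog.
  by rewrite -di; apply: (dhomog_is_dhomog (f i)).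
rewrite -mul_mpolyC rmorphM /= {1}/rank_one_subst mmapC /section_coef xi.
by rewrite (rank_one_subst_pullback _ _ hf) mul_mpolyC scalerA.
Qed.

Lemma plane_section_vanishing (phi : forms K n d -> K) :
    (n <= N)%N -> (forall i, (0 < d i)%N) -> polynomial_fun phi ->
    (forall A, phi (plane_section n f A) = 0) ->
  (forall F, phi F = 0) \/ jacobian_dep (fun x => d (coef_form x)) section_coef.
Proof.
move=> nN d0 /polynomial_fun_coef [Q phiE] phi0.
have [Q0|Q0] := eqVneq Q 0; first by left=> F; rewrite phiE Q0 meval0.
right.
have [|g [i gi] gF] := jacobian_of_algebraic_dep (F := section_coef) K0 Q0.
  apply: eq0_of_injective_vanishing => // M Minj.
  rewrite (mmap_comp _ _ (meval _)) -[RHS](phi0 (exist _ M Minj)) phiE.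
  apply: eq_mmap => [b|k] /=; first by rewrite mevalC.
  exact: generic_pullback_eval.
by exists g => //; exists i.
Qed.

End Sections.

(** By Euler's identity a form of degree d is 1/d times the sum of the N+1
    products x_j del_j f, and for d >= 2 both factors have positive degree. *)
Lemma low_combination_nvars (K : fieldType) c N (d : 'I_c -> nat)
    (f : forms K N d) :
    [pchar K] =i pred0 -> (0 < c)%N -> (forall i, (2 <= d i)%N) ->
  low_combination d (fun i => f i : {mpoly K[N.+1]}) N.+1.
Proof.
move=> K0 c0 d2; move: (Ordinal c0) => i0 {c0}.
exists (d i0), (fun i => (i == i0)%:R); split.
- by apply: leq_trans (d2 i0).
- by exists i0 => //; rewrite eqxx oner_neq0.
have -> : \sum_(i | d i == d i0) (i == i0)%:R *: (f i : {mpoly K[N.+1]}) =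
    (d i0)%:R^-1 *: \sum_j 'X_j * mderiv j (f i0 : {mpoly K[N.+1]}).
  rewrite (euler_mpoly (dhomog_is_dhomog (f i0))) scalerA mulVf; last first.
    by rewrite pchar0_natr_eq0 // -lt0n; apply: leq_trans (d2 i0).
  rewrite (bigD1 i0) //= eqxx big1 ?addr0 // => i /andP [_ /negbTE ->].
  by rewrite scale0r.
apply: low_strengthZ.
rewrite -[X in low_strength _ X]muln1 -[X in (X * _)%N]card_ord.
apply: low_strength_sum => j _.
apply: (low_strengthM (u := 1) (v := (d i0).-1)) => //.
- by have := d2 i0; case: (d i0) => [|[|]].
- by have := d2 i0; case: (d i0).
- by rewrite dhomogX; apply/eqP/mdeg1.
by apply: mderiv_dhomog; apply: (dhomog_is_dhomog (f i0)).
Qed.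

(** The summand n+1 in the bound forces n <= N. *)
Lemma dominant_of_collective_strength (K : fieldType) c (d : 'I_c -> nat) n :
    [pchar K] =i pred0 -> (0 < c)%N -> (forall i, (2 <= d i)%N) ->
  exists m : nat, forall N (f : forms K N d),
    collective_strength_ge f m%:Z -> dominant (plane_section n f).
Proof.
move=> K0 c0 d2.
have [m0 H0] := jacobian_dep_low_combination (\max_i d i)
  #|coef_index n d| #|coef_index n d|.
exists (m0 + n.+1)%N => N f fm.
have nN : (n <= N)%N.
  have := collective_strength_lt fm (low_combination_nvars f K0 c0 d2).
  rewrite ltz_nat => mN; rewrite -ltnS; apply: leq_ltn_trans mN.
  by rewrite addnS ltnW // ltnS leq_addl.
apply: dominant_of_polynomial_fun => phi phiP phi0.
have [|//|dep] := plane_section_vanishing K0 nN _ phiP phi0.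
  by move=> i; apply: ltnW.
have lc : low_combination (fun x : coef_index n d => d (coef_form x))
    (section_coef f) m0.
  apply: H0 => //.
  - by move=> x; apply: leq_bigmax.
  - exact: max_card.
  - move=> x; apply: generic_pullback_dhomog.
    exact: (dhomog_is_dhomog (f _)).
have := collective_strength_lt fm (low_combination_section_coef K0 lc).
by rewrite ltz_nat ltnNge leq_addr.
Qed.

Theorem theorem1p2 (R : realType) (c : nat) (d : 'I_c -> nat) (n : nat)
    (c_gt0 : (0 < c)%N) (d_ge2 : forall i, (2 <= d i)%N) (n_gt0 : (0 < n)%N) :
  exists m : int,
    forall (N : nat) (f : forms R[i] N d),
      (0 < N)%N ->
      collective_strength_ge f m ->
      dominant (plane_section n f).
Proof.
have [m H] := @dominant_of_collective_strength R[i] c d n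
  (pchar_num _) c_gt0 d_ge2.
by exists m%:Z => N f _; apply: H.
Qed.
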